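(* Let $D$ be a connected, reduced, checkerboard-colored link diagram with at least one crossing and with associated Tait graph $G$, and let $\sigma$ be a state of $D$. Let $E_{\sigma}\subseteq E(G)$ be the edge subset determined by $\sigma$, namely the union of the $+$ edges whose crossings are A-resolved by $\sigma$ and the $-$ edges whose crossings are B-resolved by $\sigma$, and let $\overline{E_{\sigma}}=E(G)-E_{\sigma}$. Then $D$ is $\sigma$-adequate with respect to the state $\sigma$ if and only if the partition $E(G)=E_{\sigma}\sqcup\overline{E_{\sigma}}$ satisfies the following conditions. (1) Every edge of $E_{\sigma}$ is contained in a cycle of $G|E_{\sigma}$. (2) No edge of $\overline{E_{\sigma}}$ has both of its endpoints on a single connected component of $G|E_{\sigma}$.
   Context: A link diagram $D\subseteq\mathbb{R}^2$ has a projection graph $\Gamma_D$, obtained by replacing crossings with 4-valent vertices; $D$ is connected if $\Gamma_D$ is connected, and the regions of $D$ are the complementary regions of $\Gamma_D$. $D$ is reduced if it has no nugatory crossing, i.e. no crossing that meets a region of $D$ more than once. $D$ is checkerboard-colored if each region is shaded black or white so that near each crossing two opposite regions are black and the other two opposite regions are white. States. At each crossing one may perform the A-resolution (the smoothing joining the two regions swept out when the over-strand is rotated counterclockwise toward the under-strand) or the B-resolution (the other smoothing). A state $\sigma$ of $D$ is a choice of A- or B-resolution at each crossing. Resolving all crossings according to $\sigma$ gives the state graph $H_\sigma$, consisting of disjoint state circles together with one state segment (A-segment or B-segment) per crossing, recording the location and type of the resolution. $D$ is $\sigma$-adequate with respect to $\sigma$ if no state segment of $H_\sigma$ connects a state circle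 to itself. Tait graph. The Tait graph $G$ of a checkerboard-colored diagram $D$ is the plane multigraph with one vertex per black region and one edge per crossing, joining the vertices of the two black regions meeting at that crossing (a loop if the same black region meets the crossing twice). Its edges are signed: an edge is $+$ if the A-resolution of its crossing locally joins the two black regions (so the B-resolution separates them), and $-$ if the B-resolution locally joins the two black regions (so the A-resolution separates them). For $H\subseteq E(G)$, $G|H$ is the spanning subgraph of $G$ with all the vertices of $G$ and edge set $H$. Cycles may have length two (parallel edges); isolated vertices count as connected components. *)

(* Defs.v *)
From HB Require Import structures.
From mathcomp Require Import all_boot all_algebra.
Set Implicit Arguments.
Unset Strict Implicit.
Unset Printing Implicit Defensive.
Import GRing.Theory.
Local Open Scope ring_scope.

(* Meaningful when [connect e] is symmetric, as is the case in every use
   below. *)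
Definition class (T : finType) (e : rel T) (x : T) : {set T} :=
  [set y | connect e x y].

Definition classes (T : finType) (e : rel T) : {set {set T}} :=
  [set class e x | x : T].

(** * Multigraphs *)

(* A loop is an edge with a single end. *)
Record multigraph := Multigraph {
  vertex : finType;
  edge : finType;
  ends : edge -> {set vertex};
  ends_card : forall e, (0 < #|ends e| <= 2)%N
}.

Definition is_loop (G : multigraph) (e : edge G) : Prop :=
  exists v, ends e = [set v].

Definition adjacent (G : multigraph) : rel (vertex G) :=
  fun u v => [exists e : edge G, ends e == [set u; v]].
Arguments adjacent : clear implicits.

Definition components (G : multigraph) : {set {set vertex G}} :=
  classes (adjacent G).

Definition connected_graph (G : multigraph) : Prop :=
  forall u v : vertex G, connect (adjacent G) u v.

(* The cycle v_0 e_0 v_1 e_1 ... v_(n-1) e_(n-1) v_0 is the sequence of the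
   pairs (v_i, e_i).  Length 1 is a loop, length 2 a pair of parallel edges. *)
Definition is_cycle (G : multigraph) (s : seq (vertex G * edge G)) : bool :=
  [&& s != [::], uniq (unzip1 s), uniq (unzip2 s)
    & cycle (fun p q => ends p.2 == [set p.1; q.1]) s].

Definition spanning_subgraph (G : multigraph) (H : {set edge G}) : multigraph :=
  @Multigraph (vertex G) {e : edge G | e \in H}
    (fun e => ends (val e)) (fun e => ends_card (val e)).

(** * Link diagrams *)

(* Planar diagram codes.  The half-edges at a crossing c are (c, 0), (c, 1),
   (c, 2), (c, 3) in counterclockwise order, (c, 0) and (c, 2) forming the
   under-strand and (c, 1) and (c, 3) the over-strand; [glue] matches the two
   halves of each edge of the projection graph. *)
Record pd_code := PDCode {
  crossing : finType;
  glue : crossing * 'I_4 -> crossing * 'I_4;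
  glueK : involutive glue;
  glue_neq : forall h, glue h != h
}.

Definition half_edge (D : pd_code) : finType := (crossing D * 'I_4)%type.

Definition arcs (D : pd_code) : {set {set half_edge D}} :=
  [set [set h; glue h] | h : half_edge D].

Lemma projection_ends_card (D : pd_code)
    (a : {a : {set half_edge D} | a \in arcs D}) :
  (0 < #|[set h.1 | h in val a]| <= 2)%N.
Proof.
case: a => a /= /imsetP[h _ ->]; rewrite imsetU1 imset_set1.
by rewrite cards2; case: (_ != _).
Qed.

Definition projection_graph (D : pd_code) : multigraph :=
  Multigraph (@projection_ends_card D).

(* The half-edge (c, i) also stands for the corner of c between (c, i) and
   (c, i + 1).  Leaving c along (c, i) with this corner on the left, one
   reaches the crossing of glue (c, i) = (c', j) in its corner (c', j - 1). *)
Definition next_corner (D : pd_code) (h : half_edge D) : half_edge D :=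
  ((glue h).1, (glue h).2 - 1).
Arguments next_corner : clear implicits.

(* The closed walks around the regions.  When the diagram is connected each
   region has exactly one boundary walk, so these are the regions. *)
Definition region_at (D : pd_code) (h : half_edge D) : {set half_edge D} :=
  class (frel (next_corner D)) h.

Definition regions (D : pd_code) : {set {set half_edge D}} :=
  classes (frel (next_corner D)).

(* Euler's formula: every component of the projection graph has genus 0.  The
   choice of the unbounded region is not recorded. *)
Definition planar (D : pd_code) : Prop :=
  let Gamma := projection_graph D in
  (#|vertex Gamma| + #|regions D| = #|edge Gamma| + 2 * #|components Gamma|)%N.

Record link_diagram := LinkDiagram {
  pd :> pd_code;
  pd_planar : planar pd
}.

Definition connected_diagram (D : link_diagram) : Prop :=
  connected_graph (projection_graph D).

Definition reduced (D : link_diagram) : Prop :=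
  forall c : crossing D, injective (fun i : 'I_4 => region_at (c, i)).

Record checkerboard (D : link_diagram) := Checkerboard {
  black :> {set {set half_edge D}};
  black_regions : black \subset regions D;
  black_alternate : forall (c : crossing D) (i : 'I_4),
    (region_at (c, i + 1) \in black) = (region_at (c, i) \notin black)
}.

(** * States *)

Variant resolution := Ares | Bres.

Definition is_Ares (r : resolution) : bool := if r is Ares then true else false.

Lemma is_AresK : cancel is_Ares (fun b : bool => if b then Ares else Bres).
Proof. by case. Qed.

HB.instance Definition _ := Equality.copy resolution (can_type is_AresK).

(* The corners joined by a resolution: rotating the over-strand
   counterclockwise, its half-edges 1 and 3 sweep the corners 1 and 3. *)
Definition joins (r : resolution) (i : 'I_4) : bool :=
  if r is Ares then odd i else ~~ odd i.

(* The half-edge i lies between the corners i - 1 and i, exactly one of which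
   is joined by r; the resolved strand turns around the other one. *)
Definition smooth (r : resolution) (i : 'I_4) : 'I_4 :=
  if joins r i then i - 1 else i + 1.

Definition state (D : link_diagram) := crossing D -> resolution.

Section StateGraph.
Variables (D : link_diagram) (sigma : state D).

Definition state_step : rel (half_edge D) :=
  fun h k => (k == glue h) || (k == (h.1, smooth (sigma h.1) h.2)).

Definition state_circles : {set {set half_edge D}} := classes state_step.

Definition state_circle : finType := {C : {set half_edge D} | C \in state_circles}.

(* The state segment of c joins the two strands resolving c, so its ends are
   the state circles through the half-edges at c. *)
Definition segment_ends (c : crossing D) : {set state_circle} :=
  [set C : state_circle | [exists i : 'I_4, (c, i) \in val C]].

Lemma state_step_sym : connect_sym state_step.
Proof.
apply: sym_connect_sym.
have smoothK r : involutive (smooth r).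
  by case: r => -[[|[|[|[|]]]] //= ?]; apply/val_inj.
have step h k : state_step h k -> state_step k h.
  case/orP=> /eqP->; apply/orP; [left | right]; first by rewrite glueK.
  by rewrite /= smoothK; case: h.
by move=> h k; apply/idP/idP; apply: step.
Qed.

Lemma segment_ends_card (c : crossing D) : (0 < #|segment_ends c| <= 2)%N.
Proof.
have circ h : class state_step h \in state_circles by exact: imset_f.
pose C h : state_circle := exist (fun K => is_true (K \in state_circles)) _ (circ h).
have CE (K : state_circle) h : h \in val K -> K = C h.
  case: K => K /= KP; case/imsetP: (KP) => k _ EK hK.
  apply: val_inj; rewrite /= EK; apply/setP=> l; rewrite !inE.
  apply: (same_connect state_step_sym).
  by move: hK; rewrite EK inE.
have smoothE i : C (c, i) = C (c, smooth (sigma c) i).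
  apply: CE; rewrite inE; apply: connect1.
  by apply/orP; right; apply: eqxx.
have [] : C (c, 1) = C (c, 0) /\ C (c, 3) = C (c, 2) \/
          C (c, 1) = C (c, 2) /\ C (c, 3) = C (c, 0).
  have := (smoothE 1, smoothE 3); rewrite /smooth /=.
  case: (sigma c) => -[E1 E3]; [left | right]; rewrite E1 E3;
    by split; congr (C (_, _)); apply: val_inj.
all: move=> [E1 E3].
all: have sub : segment_ends c \subset [set C (c, 0); C (c, 2)].
1,3: apply/subsetP=> K; rewrite !inE => /existsP[i /CE ->];
  have : [|| i == 0, i == 1, i == 2 | i == 3]
    by case: i => -[|[|[|[|]]]].
1,2: by case/or4P=> /eqP->; rewrite ?E1 ?E3 eqxx ?orbT.
all: apply/andP; split;
  last by apply: leq_trans (subset_leq_card sub) _; rewrite cards2; case: (_ != _).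
all: apply/card_gt0P; exists (C (c, 0)); rewrite inE; apply/existsP.
all: by exists 0; rewrite inE.
Qed.

Definition state_graph : multigraph := Multigraph segment_ends_card.

Definition adequate : Prop := forall s : edge state_graph, ~ is_loop s.

End StateGraph.

(** * Tait graphs *)

Section TaitGraph.
Variables (D : link_diagram) (B : checkerboard D).

Definition black_region : finType := {R : {set half_edge D} | R \in black B}.

Definition tait_ends (c : crossing D) : {set black_region} :=
  [set R : black_region | [exists i : 'I_4, val R == region_at (c, i)]].

Lemma tait_ends_card (c : crossing D) : (0 < #|tait_ends c| <= 2)%N.
Proof.
have alt := black_alternate B c.
pose b : 'I_4 := if region_at (c, 0) \in black B then 0 else 1.
have bB : region_at (c, b) \in black B.
  by rewrite /b; case: ifP => // n0; rewrite -[1]add0r alt n0.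
have bB2 : region_at (c, b + 1 + 1) \in black B by rewrite !alt negbK.
have bB1 : region_at (c, b + 1) \notin black B by rewrite alt negbK.
have bB3 : region_at (c, b + 1 + 1 + 1) \notin black B by rewrite alt negbK.
pose R0 : black_region := exist (fun R => is_true (R \in black B)) _ bB.
pose R2 : black_region := exist (fun R => is_true (R \in black B)) _ bB2.
have sub : tait_ends c \subset [set R0; R2].
  apply/subsetP=> R; rewrite !inE => /existsP[i /eqP Ri].
  have : [|| i == b, i == b + 1, i == b + 1 + 1 | i == b + 1 + 1 + 1].
    by rewrite /b; case: ifP => _; case: i {Ri} => -[|[|[|[|]]]].
  have RB := valP R; rewrite Ri in RB.
  case/or4P=> /eqP ib; rewrite {}ib in Ri RB.
  - by apply/orP; left; apply/eqP/val_inj.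
  - by rewrite RB in bB1.
  - by apply/orP; right; apply/eqP/val_inj.
  - by rewrite RB in bB3.
apply/andP; split.
  by apply/card_gt0P; exists R0; rewrite inE; apply/existsP; exists b.
by apply: leq_trans (subset_leq_card sub) _; rewrite cards2; case: (_ != _).
Qed.

Definition tait_graph : multigraph := Multigraph tait_ends_card.

Definition joins_black (r : resolution) (c : crossing D) : bool :=
  [forall i : 'I_4, joins r i ==> (region_at (c, i) \in black B)].

Definition plus_edges : {set edge tait_graph} := [set c | joins_black Ares c].

Definition minus_edges : {set edge tait_graph} := [set c | joins_black Bres c].

Definition state_edges (sigma : state D) : {set edge tait_graph} :=
  [set c in plus_edges | sigma c == Ares] :|:
  [set c in minus_edges | sigma c == Bres].

End TaitGraph.

(* Main.v *)
Require Import Defs.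
From HB Require Import structures.
From mathcomp Require Import all_boot all_algebra.
From mathcomp Require Import zify.
Set Implicit Arguments.
Unset Strict Implicit.
Unset Printing Implicit Defensive.

(** Shade the plane surface made of a disc for each black region and a band for
each crossing in E = E_sigma.  Its boundary circles are the state circles of
sigma: a crossing in E joins its two black corners, any other separates them.
Now let c be a crossing outside E.

If the segment of c has both ends on one state circle, then its two black
corners lie on the same component of G|E, because following a state circle
never leaves a component (connect_black_beside).  The converse is where
planarity enters.  It comes from the count, for every set E of edges,

  #circles(E) + #vertices = 2 #components(E) + #E

(circles_comps), which says that every component of G|E has genus 0.  The
right side minus the left side cannot decrease when an edge is added to E
(defect_mono).  For E empty the circles are the boundaries of the black
regions, for E full they are those of the white regions; at both ends
the equality holds, in the second case by Euler's formula for the projection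
graph and connectedness of the Tait graph.  Hence it holds for all E in between.

Adding c to E changes the number of components by 0 or 1, according to whether
c has its ends on one component of G|E, so by the count it splits a circle in the
first case and merges two circles in the second (loop_at_linked).  Thus

- c outside E has its segment on one circle iff both ends of c are on one
  component of G|E, which is the negation of (2);
- c inside E, compared with E - c, has its segment on one circle iff the ends of c
  are on different components of G|(E - c), that is iff c is a bridge of G|E, which
  is the negation of (1) (in_cycleP).

Orientations of the circles are never used.  That a crossing whose
segment joins two distinct circles merges them when it is resolved the other
way is a parity count (loop_at_flip). *)

(** * Counting classes and pairs *)

Section Classes.
Variable T : finType.
Implicit Types (e : rel T) (x y u v : T).

Lemma eq_class e x y :
  connect_sym e -> (class e x == class e y) = connect e x y.
Proof.
move=> esym; apply/eqP/idP => [E | exy].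
  by have := connect0 e y; have /setP/(_ y) := E; rewrite !inE => ->.
by apply/setP=> z; rewrite !inE (same_connect esym exy).
Qed.

Lemma connect_classes e e' : connect e =2 connect e' -> classes e = classes e'.
Proof.
by move=> E; apply: eq_imset => x; apply/setP=> y; rewrite !inE E.
Qed.

Lemma card_classes_fun (V : finType) e (f : T -> V) :
  (forall v : V, exists x, f x = v) ->
  (forall x y, connect e x y = (f x == f y)) -> #|classes e| = #|V|.
Proof.
move=> fsurj ef.
pose g (v : V) := [set y | f y == v].
have -> : classes e = g @: V.
  apply/setP=> C; apply/imsetP/imsetP => -[x _ ->].
    by exists (f x) => //; apply/setP=> y; rewrite !inE ef eq_sym.
  have [z <-] := fsurj x; exists z => //.
  by apply/setP=> y; rewrite !inE ef eq_sym.
rewrite card_imset // => v w /setP gvw; have [x fx] := fsurj v.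
by have := gvw x; rewrite !inE fx eqxx => /esym/eqP.
Qed.

Lemma card_one_class e x : (forall y z, connect e y z) -> #|classes e| = 1.
Proof.
move=> conn; rewrite -card_unit; apply: (card_classes_fun (f := fun=> tt)).
  by case; exists x.
by move=> y z; rewrite conn.
Qed.

(** The relation e' generates the same equivalence as e together with the pair
(x, y).  The last hypothesis is stated up to e, since the relations used below
add several pairs at once, all equivalent to (x, y) modulo e. *)
Lemma card_classes_merge e e' x y :
    connect_sym e -> connect_sym e' ->
    subrel e (connect e') -> connect e' x y ->
    (forall u v, e' u v -> connect e u v \/
       (connect e u x || connect e u y) && (connect e v x || connect e v y)) ->
  #|classes e| = #|classes e'| + ~~ connect e x y.
Proof.
move=> esym e'sym sub e'xy e'E.
have subc : subrel (connect e) (connect e') by apply: connect_sub.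
pose M u := connect e u x || connect e u y.
have Mcl u v : connect e u v -> M u = M v.
  by move=> uv; rewrite /M !(same_connect esym uv).
have e'sub u v : connect e' u v -> connect e u v \/ M u && M v.
  case/connectP=> p; elim: p u => [|w p IH] u /=.
    by move=> _ ->; left; apply: connect0.
  case/andP=> /e'E uw /IH{}IH /IH wv.
  case: uw wv => [uw | /andP[Mu Mw]] [wv | /andP[Mw' Mv]].
  - by left; apply: connect_trans wv.
  - by right; rewrite (Mcl _ _ uw) Mw' Mv.
  - by right; rewrite -(Mcl _ _ wv) /M Mu Mw.
  - by right; rewrite /M Mu.
have [exy | nexy] /= := boolP (connect e x y).
  rewrite addn0; congr #|pred_of_set _|; apply: connect_classes => u v.
  apply/idP/idP => [/subc // | /e'sub[//|/andP[Mu Mv]]].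
  have Mx w : M w -> connect e w x.
    by case/orP=> // wy; apply: connect_trans wy _; rewrite esym.
  by apply: connect_trans (Mx _ Mu) _; rewrite esym Mx.
have M' u v : M u -> M v -> connect e' u v.
  have Mx w : M w -> connect e' w x.
    by case/orP => /subc // wy; apply: connect_trans wy _; rewrite e'sym.
  by move=> /Mx ux /Mx vx; apply: connect_trans ux _; rewrite e'sym.
have Mx : M x by rewrite /M connect0.
have My : M y by rewrite /M connect0 orbT.
(* The classes other than those of x and y are common to e and e'. *)
pose rest := [set class e u | u in [pred u | ~~ M u]].
have restN u : M u -> class e u \notin rest.
  move=> Mu; apply/imsetP => -[v /= nMv /eqP]; rewrite eq_class // => uv.
  by move: nMv; rewrite inE -(Mcl _ _ uv) Mu.
have class' u : ~~ M u -> class e' u = class e u.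
  move=> nMu; apply/setP=> v; rewrite !inE; apply/idP/idP => [/e'sub[//|] | /subc //].
  by rewrite (negPf nMu).
have restN' : class e' x \notin rest.
  apply/imsetP => -[v /= nMv /eqP]; rewrite -class' // eq_class //.
  by case/e'sub => [/Mcl|/andP[_]]; rewrite ?Mx (negPf nMv).
have -> : classes e = class e x |: (class e y |: rest).
  apply/setP=> C; rewrite !in_setU1; apply/imsetP/or3P => [[u _ ->]|].
    have [/orP[ux|uy]|nMu] := boolP (M u).
    - by constructor 1; rewrite eq_class.
    - by constructor 2; rewrite eq_class.
    - by constructor 3; apply: imset_f.
  by case=> [/eqP->|/eqP->|/imsetP[u _ ->]]; [exists x | exists y | exists u].
have -> : classes e' = class e' x |: rest.
  apply/setP=> C; rewrite !in_setU1; apply/imsetP/orP => [[u _ ->]|].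
    have [Mu|nMu] := boolP (M u); first by left; rewrite eq_class // M'.
    by right; rewrite class' //; apply: imset_f.
  case=> [/eqP->|/imsetP[u nMu ->]]; [by exists x | exists u => //].
  by rewrite class'.
rewrite !cardsU1 restN' (restN _ My) in_setU1 negb_or (restN _ Mx) andbT.
by rewrite eq_class // nexy; lia.
Qed.

(** A fixed-point-free involution cuts a stable set into pairs.  This counts the
edges of a projection graph and gives the parity in loop_at_flip. *)
Lemma card_involution (f : T -> T) (A : {set T}) :
    involutive f -> (forall x, f x != x) -> (forall x, x \in A -> f x \in A) ->
  #|A| = #|[set [set x; f x] | x in A]| * 2.
Proof.
move=> fK fneq fA; set P := imset _ _.
have Peq x y : y \in [set x; f x] -> [set y; f y] = [set x; f x].
  by case/set2P=> ->; rewrite // fK setUC.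
apply: card_uniform_partition => [_ /imsetP[x _ ->]|].
  by rewrite cards2 eq_sym fneq.
apply/and3P; split.
- apply/eqP/setP=> y; apply/bigcupP/idP => [[_ /imsetP[x xA ->]] | yA].
    by case/set2P=> ->; rewrite ?fA.
  by exists [set y; f y]; rewrite ?set21 //; apply: imset_f.
- apply/trivIsetP=> _ _ /imsetP[x _ ->] /imsetP[y _ ->].
  by apply: contraR => /pred0Pn[z /andP[/= /Peq <- /Peq <-]].
- by apply/imsetP => -[x _] /setP/(_ x); rewrite !inE eqxx.
Qed.
Lemma set2_inj (a b c d : T) :
  [set a; b] = [set c; d] -> (a = c /\ b = d) \/ (a = d /\ b = c).
Proof.
move=> /setP E; have := (E a, E b, (E c, E d)); rewrite !inE !eqxx ?orbT /=.
case=> -[/esym/orP[]/eqP-> /esym/orP[]/eqP->] [/orP[]/eqP E1 /orP[]/eqP E2];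
  by subst; auto.
Qed.

End Classes.

(** * Components and cycles of multigraphs *)

Section Multigraphs.
Variable G : multigraph.
Implicit Types (E : {set edge G}) (e : edge G) (u v : vertex G).

Definition adjacent_in E : rel (vertex G) := adjacent (spanning_subgraph E).

Lemma adjacent_inP E u v :
  reflect (exists2 e, e \in E & ends e = [set u; v]) (adjacent_in E u v).
Proof.
apply: (iffP existsP) => [[[e eE] /eqP ee] | [e eE ee]]; first by exists e.
by exists (Sub e eE : edge (spanning_subgraph E)); apply/eqP.
Qed.

Lemma adjacent_in_sym E : connect_sym (adjacent_in E).
Proof.
apply: sym_connect_sym => u v.
by apply/adjacent_inP/adjacent_inP => -[e eE ee]; exists e; rewrite // setUC.
Qed.

Lemma connect_adjacent_in_sub E E' u v :
  E \subset E' -> connect (adjacent_in E) u v -> connect (adjacent_in E') u v.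
Proof.
move=> /subsetP sEE'; apply: connect_sub => {u v} u v /adjacent_inP[e eE ee].
by apply/connect1/adjacent_inP; exists e; rewrite ?sEE'.
Qed.

Lemma card_components_add E e u v :
  ends e = [set u; v] ->
  #|components (spanning_subgraph E)| =
  #|components (spanning_subgraph (e |: E))| + ~~ connect (adjacent_in E) u v.
Proof.
move=> ee; apply: (card_classes_merge (e' := adjacent_in (e |: E)));
  try exact: adjacent_in_sym.
- by move=> a b ab; apply: connect_adjacent_in_sub (subsetUr _ _) _; apply: connect1.
- by apply/connect1/adjacent_inP; exists e; rewrite ?setU11.
move=> a b /adjacent_inP[f /setU1P[-> | fE] fe]; last first.
  by left; apply/connect1/adjacent_inP; exists f.
right; rewrite ee in fe.
by case: (set2_inj fe) => -[-> ->]; rewrite !connect0 ?orbT.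
Qed.

Lemma card_components_set0 :
  #|components (spanning_subgraph (set0 : {set edge G}))| = #|vertex G|.
Proof.
apply: (card_classes_fun (f := id)) => [v|u v]; first by exists v.
apply/connectP/eqP => [[[|w p] //= /andP[/adjacent_inP[e]]]|->]; last by exists [::].
by rewrite inE.
Qed.

Lemma in_one_componentP E e u v : ends e = [set u; v] ->
  connect (adjacent_in E) u v <->
  exists K : {set vertex (spanning_subgraph E)},
    K \in components (spanning_subgraph E) /\ ends e \subset K.
Proof.
move=> ee; split=> [uv | [_ [/imsetP[w _ ->]]]].
  exists (class (adjacent_in E) u); split; first exact: imset_f.
  by rewrite ee; apply/subsetP=> w /set2P[] ->; rewrite inE ?connect0.
rewrite ee => /subsetP sub.
have := sub u; rewrite set21 inE => /(_ isT) wu.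
have := sub v; rewrite set22 inE => /(_ isT) wv.
by apply: connect_trans wv; rewrite adjacent_in_sym.
Qed.

(** Choosing an edge for each step of a simple vertex path gives distinct edges:
the edge leaving v has v as an end, whereas the ends of the later edges
lie on the rest of the path.  The last clause is about appending q and prepending
a, so that the walk can be closed up by a single edge into a cycle. *)
Lemma path_walk E v p :
  path (adjacent_in E) v p -> uniq (v :: p) ->
  exists s : seq (vertex G * edge G),
    [/\ unzip1 s = belast v p, uniq (unzip2 s),
        forall f, f \in unzip2 s -> f \in E /\ ends f \subset v :: p &
        forall a q, ends a.2 = [set a.1; v] -> q.1 = last v p ->
          path (fun p q => ends p.2 == [set p.1; q.1]) a (rcons s q)].
Proof.
elim: p v => [|w p IH] v /=.
  by move=> _ _; exists [::]; split=> // a q /= -> ->; rewrite eqxx.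
case/andP=> /adjacent_inP[e eE ee] wp /andP[vwp uwp].
have [s [s1 us sE sp]] := IH _ wp uwp.
exists ((v, e) :: s); split=> /= [|||a q aE qE].
- by rewrite s1.
- rewrite us andbT; apply/negP => /sE[_ /subsetP/(_ v)].
  by rewrite ee set21 => /(_ isT) vw; move: vwp; rewrite vw.
- move=> f; rewrite inE => /predU1P[-> | /sE[fE fs]]; split=> //.
    by apply/subsetP=> x; rewrite ee => /set2P[] ->; rewrite !inE eqxx ?orbT.
  by apply: subset_trans fs _; apply/subsetP=> x; rewrite !(inE, in_cons) => ->; rewrite orbT.
- by rewrite aE eqxx /=; apply: sp.
Qed.

Lemma walk_connect E a s q :
    path (fun p q : vertex G * edge G => ends p.2 == [set p.1; q.1]) a (rcons s q) ->
    {subset unzip2 s <= E} ->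
  exists2 w, ends a.2 = [set a.1; w] & connect (adjacent_in E) w q.1.
Proof.
elim: s a => [|b s IH] a /=.
  by case/andP=> /eqP aE _ _; exists q.1; rewrite ?connect0.
case/andP=> /eqP aE /IH{}IH sE; exists b.1 => //.
have [|w bE wq] := IH; first by move=> f fs; apply: sE; rewrite inE fs orbT.
apply: connect_trans wq; apply/connect1/adjacent_inP; exists b.2 => //.
by apply: sE; apply: mem_head.
Qed.

(** An edge lies on a cycle iff it is not a bridge. *)
Lemma in_cycleP e u v : ends e = [set u; v] ->
  (exists s : seq (vertex G * edge G), is_cycle s /\ e \in unzip2 s) <->
  connect (adjacent_in [set~ e]) u v.
Proof.
move=> ee; split=> [[s [/and4P[_ _ us cs]]] | ].
  case/mapP=> -[x f] /= xfs ef; rewrite -{f}ef in xfs.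
  (* Rotate e to the front: the rest of the cycle is a walk avoiding e. *)
  have [i s' rots] := rot_to xfs.
  move: cs; rewrite -(rot_cycle i) rots /= => cs.
  have s'E : {subset unzip2 s' <= [set~ e]}.
    move=> f fs; rewrite !inE; apply: contraL fs => /eqP->.
    by move: us; rewrite -(rot_uniq i) -map_rot rots /= => /andP[].
  have [w /=] := walk_connect cs s'E.
  by rewrite ee => /set2_inj[] [-> ->] //; rewrite adjacent_in_sym.
rewrite adjacent_in_sym => /connectP[p0 vp0 ulast].
case/shortenP: vp0 ulast => p vp up _ ulast.
have [s [s1 us sE sp]] := path_walk vp up.
exists ((u, e) :: s); split; last exact: mem_head.
apply/and4P; split=> //=.
- by rewrite s1 {1}ulast -rcons_uniq -lastI.
- by rewrite us andbT; apply/negP => /sE[]; rewrite !inE eqxx.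
- exact: sp.
Qed.

End Multigraphs.

(** * State circles and the change of one resolution *)

Section Resolutions.
Local Open Scope ring_scope.
Import GRing.Theory.
Implicit Types (r : resolution) (i j : 'I_4).

Lemma ord4P i : [|| i == 0, i == 1, i == 2 | i == 3].
Proof. by case: i => -[|[|[|[|]]]]. Qed.

Lemma smoothK r : involutive (smooth r).
Proof. by case: r => -[[|[|[|[|]]]] //= ?]; apply/val_inj. Qed.

Lemma smooth_neq r i : smooth r i != i.
Proof. by case: r; case: i => -[|[|[|[|]]]]. Qed.

Lemma smooth_smooth r r' i :
  smooth r' (smooth r i) = if r == r' then i else i + 2.
Proof. by case: r; case: r'; case: i => -[|[|[|[|]]]] //= ?; apply/val_inj. Qed.

Lemma smooth_cases r i j : [\/ j = i, j = smooth r i, j = i + 2 | j = smooth r (i + 2)].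
Proof.
case: r; move: (ord4P i) (ord4P j) => /or4P[] /eqP -> /or4P[] /eqP ->;
  by [constructor 1; apply/val_inj | constructor 2; apply/val_inj
     | constructor 3; apply/val_inj | constructor 4; apply/val_inj].
Qed.
End Resolutions.

Section StateCircles.
Local Open Scope ring_scope.
Import GRing.Theory.
Variable D : link_diagram.
Implicit Types (sigma tau : state D) (c : crossing D) (h k : half_edge D).

(** The half-edges 0 and 2 lie on different strands for both resolutions, so this
says that the segment of c has both ends on one circle. *)
Definition loop_at sigma c : bool :=
  connect (state_step sigma) (c, 0) (c, 2).

Lemma state_step_glue sigma h : connect (state_step sigma) h (glue h).
Proof. by apply: connect1; rewrite /state_step eqxx. Qed.

Lemma state_step_smooth sigma c i :
  connect (state_step sigma) (c, i) (c, smooth (sigma c) i).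
Proof. by apply: connect1; rewrite /state_step eqxx orbT. Qed.

Lemma eq_state_step sigma tau : sigma =1 tau -> state_step sigma =2 state_step tau.
Proof. by move=> E h k; rewrite /state_step E. Qed.

(** The resolution at c consists of two strands, one through (c, 0) and the other
through (c, 2). *)
Lemma circle_through sigma c i :
  connect (state_step sigma) (c, i) (c, 0) || connect (state_step sigma) (c, i) (c, 2).
Proof.
have sm := state_step_smooth sigma c; have sy := @state_step_sym D sigma.
case: (smooth_cases (sigma c) 0 i) => ->; rewrite ?add0r.
- by rewrite connect0.
- by rewrite sy sm.
- by rewrite connect0 orbT.
- by rewrite (sy _ (c, 2)) sm orbT.
Qed.

Lemma adequateP sigma : adequate sigma <-> forall c, ~~ loop_at sigma c.
Proof.
have sy := @state_step_sym D sigma.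
have circ h : class (state_step sigma) h \in state_circles sigma by exact: imset_f.
pose C h : state_circle sigma := Sub (class (state_step sigma) h) (circ h).
have CE (K : state_circle sigma) h : h \in val K -> K = C h.
  case: K => K KP /=; case/imsetP: (KP) => k _ EK hK.
  apply/val_inj/eqP; rewrite /= EK eq_class //.
  by move: hK; rewrite EK inE.
have Cin c i : C (c, i) \in segment_ends sigma c.
  by rewrite inE; apply/existsP; exists i; rewrite inE.
split=> [ad c | nl c [K /= eK]].
  apply/negP => lc; apply: (ad c); exists (C (c, 0)); apply/setP=> K.
  apply/idP/set1P => [|->]; last exact: Cin.
  rewrite inE => /existsP[i /CE ->]; apply/val_inj/eqP; rewrite /= eq_class //.
  by case/orP: (circle_through sigma c i) => // i2; apply: connect_trans i2 _; rewrite sy.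
move/negP: (nl c); apply; rewrite /loop_at -eq_class //.
have := Cin c 0; rewrite eK => /set1P E0; have := Cin c 2; rewrite eK => /set1P E2.
by have := congr1 val (etrans E0 (esym E2)) => /= ->.
Qed.

(** All four half-edges at c are linked, so this relation does not depend on the
resolution of c: it is a common reference for the two resolutions, each of
which has one more circle if its segment is not a loop, and as many otherwise. *)
Definition fused_step sigma c : rel (half_edge D) :=
  fun h k => state_step sigma h k || (h.1 == c) && (k.1 == c).

Lemma card_circles_fused sigma c :
  #|classes (state_step sigma)| = (#|classes (fused_step sigma c)| + ~~ loop_at sigma c)%N.
Proof.
apply: card_classes_merge; first exact: state_step_sym.
- have step h k : state_step sigma h k -> state_step sigma k h.
    case/orP=> /eqP->; rewrite /state_step ?glueK ?eqxx //= smoothK.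
    by case: h => ? ?; rewrite eqxx orbT.
  apply: sym_connect_sym => h k; rewrite /fused_step andbC; congr (_ || _).
  by apply/idP/idP; apply: step.
- by move=> h k hk; apply: connect1; rewrite /fused_step hk.
- by apply: connect1; rewrite /fused_step !eqxx orbT.
move=> [c1 i] [c2 j] /orP[hk|/andP[/= /eqP-> /eqP->]]; first by left; apply: connect1.
by right; rewrite !circle_through.
Qed.

Lemma card_circles_flip sigma tau c :
  (forall c', c' != c -> sigma c' = tau c') ->
  (#|classes (state_step sigma)| + ~~ loop_at tau c =
   #|classes (state_step tau)| + ~~ loop_at sigma c)%N.
Proof.
move=> st; rewrite !(card_circles_fused _ c) addnAC; congr (_ + _ + _)%N.
congr #|pred_of_set _|; apply/connect_classes/eq_connect => -[c1 i] [c2 j].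
rewrite /fused_step /state_step /= !xpair_eqE.
have [->|/st->//] := eqVneq c1 c.
by case: (c2 == c); rewrite /= ?orbT.
Qed.

(** Cut the circles at the four half-edges of c.  The piece starting at (c, 0) is
stable under gluing and, away from c, under smoothing; both are fixed-point-free
involutions, so it meets c an even number of times, hence once more.  If
the segment of c joins two circles in sigma, this other half-edge can only
be the sigma-partner of (c, 0), which is the tau-partner of (c, 2). *)
Lemma loop_at_flip sigma tau c :
    (forall c', c' != c -> sigma c' = tau c') -> sigma c != tau c ->
  ~~ loop_at sigma c -> loop_at tau c.
Proof.
move=> st stc nl.
pose off : rel (half_edge D) :=
  fun h k => (k == glue h) || (h.1 != c) && (k == (h.1, smooth (sigma h.1) h.2)).
have subs : subrel (connect off) (connect (state_step sigma)).
  apply: connect_sub => h k /orP[/eqP->|/andP[_ /eqP->]]; first exact: state_step_glue.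
  by case: h => c' i; apply: state_step_smooth.
have subt : subrel (connect off) (connect (state_step tau)).
  apply: connect_sub => h k /orP[/eqP->|/andP[hc /eqP->]]; first exact: state_step_glue.
  by rewrite (st _ hc); case: h {hc} => c' i; apply: state_step_smooth.
pose A := [set h | connect off (c, 0) h].
pose Ac := A :&: [set h | h.1 == c].
have evenA : ~~ odd #|A|.
  rewrite (card_involution (@glueK D) (@glue_neq D)) ?oddM ?andbF // => h.
  rewrite !inE => hA.
  by apply: connect_trans hA (connect1 _); rewrite /off eqxx.
have evenD : ~~ odd #|A :\: [set h | h.1 == c]|.
  rewrite (card_involution (f := fun h => (h.1, smooth (sigma h.1) h.2)))
    ?oddM ?andbF // => [[c' i]|[c' i]|h] /=.
  - by rewrite smoothK.
  - by rewrite xpair_eqE eqxx smooth_neq.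
  rewrite !inE => /andP[hc hA]; rewrite hc /=.
  by apply: connect_trans hA (connect1 _); rewrite /off hc eqxx orbT.
have evenAc : ~~ odd #|Ac|.
  by move: evenA; rewrite -(cardsID [set h | h.1 == c] A) oddD (negPf evenD) addbF.
have [[c' j] /=] : exists h, h \in Ac :\ (c, 0).
  apply/set0Pn; apply: contraNneq evenAc => E.
  have c0 : (c, 0) \in Ac by rewrite !inE connect0 /= eqxx.
  by rewrite (cardsD1 (c, 0)) c0 E cards0.
rewrite !inE /= => /and3P[j0 offj /eqP cE]; subst c'.
have jE : j = smooth (sigma c) 0.
  case: (smooth_cases (sigma c) 0 j) => jE //; rewrite jE ?add0r in j0 offj.
  - by rewrite eqxx in j0.
  - by rewrite /loop_at (subs _ _ offj) in nl.
  - move: nl; rewrite /loop_at (connect_trans (subs _ _ offj)) //.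
    by rewrite state_step_sym state_step_smooth.
apply: connect_trans (subt _ _ offj) _; rewrite jE.
suff -> : (c, 2 : 'I_4) = (c, smooth (tau c) (smooth (sigma c) 0)) by apply: state_step_smooth.
by rewrite smooth_smooth (negPf stc) add0r.
Qed.
End StateCircles.

(** * Black regions along state circles *)

Section Checkerboards.
Local Open Scope ring_scope.
Import GRing.Theory.
Variables (D : link_diagram) (B : checkerboard D).
Implicit Types (sigma : state D) (c : crossing D) (h k : half_edge D) (i : 'I_4).

Definition is_black h : bool := region_at h \in black B.

Lemma is_blackD1 c i : is_black (c, i + 1) = ~~ is_black (c, i).
Proof. exact: black_alternate. Qed.

Lemma is_blackB1 c i : is_black (c, i - 1) = ~~ is_black (c, i).
Proof. by rewrite -[in RHS](subrK 1 i) is_blackD1 negbK. Qed.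

Lemma next_corner_inj : injective (next_corner D).
Proof.
move=> h k hk; have /= E1 := congr1 fst hk.
have /= /addIr E2 := congr1 snd hk; apply: (can_inj (@glueK D)).
by rewrite [LHS]surjective_pairing E1 E2 -surjective_pairing.
Qed.

Lemma eq_region_at h k : (region_at h == region_at k) = fconnect (next_corner D) h k.
Proof. exact: (eq_class _ _ (fconnect_sym next_corner_inj)). Qed.

Lemma region_at_next h : region_at (next_corner D h) = region_at h.
Proof. by apply/eqP; rewrite eq_sym eq_region_at fconnect1. Qed.

Lemma is_black_next h : is_black (next_corner D h) = is_black h.
Proof. by rewrite /is_black region_at_next. Qed.

(** A half-edge (c, i) lies between the corners i - 1 and i of c, exactly one of
which is black. *)
Definition black_corner h : half_edge D :=
  if is_black h then h else (h.1, h.2 - 1).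

Lemma black_corner_black h : region_at (black_corner h) \in black B.
Proof.
rewrite /black_corner; case: ifP => // /negbT nh.
by case: h nh => c i nh; rewrite -/(is_black _) is_blackB1.
Qed.

Definition black_beside h : black_region B :=
  Sub (region_at (black_corner h)) (black_corner_black h).

(** The sides of an edge keep their colors from one end to the other. *)
Lemma black_beside_glue h : black_beside (glue h) = black_beside h.
Proof.
apply/val_inj; rewrite /= /black_corner.
have bg : is_black (glue h) = ~~ is_black h.
  by rewrite -(is_black_next h) /next_corner is_blackB1 negbK -surjective_pairing.
rewrite bg; case: (is_black h) => /=; first by rewrite -[RHS]region_at_next.
by rewrite -[LHS]region_at_next /next_corner glueK.
Qed.

Lemma black_beside_surj (R : black_region B) : exists h, black_beside h = R.
Proof.
have /imsetP[h _ Rh] := subsetP (black_regions B) _ (valP R).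
exists h; apply/val_inj; rewrite /= /black_corner /is_black.
by rewrite -[region_at h]Rh (valP R) Rh.
Qed.

(** By alternation one corner decides which pair of corners is black. *)
Lemma joins_blackE r c i : joins_black B r c = (joins r i == is_black (c, i)).
Proof.
have b0 : is_black (c, 1) = ~~ is_black (c, 0) by rewrite -is_blackD1 add0r.
have b1 : is_black (c, 2) = is_black (c, 0).
  by rewrite -[is_black (c, 0)]negbK -b0 -is_blackD1.
have b2 : is_black (c, 3) = ~~ is_black (c, 0).
  by rewrite -b1 -is_blackD1; congr (is_black (_, _)); apply/val_inj.
have bE j : is_black (c, j) = odd j (+) is_black (c, 0).
  case/or4P: (ord4P j) => /eqP ->; rewrite ?b0 ?b1 ?b2 //.
rewrite bE; transitivity (joins r 0 == is_black (c, 0)); last first.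
  by case: r => /=; case: (odd i); case: is_black.
apply/forallP/eqP => [J | J j].
  have := J 0; have := J 1; rewrite -!/(is_black _) b0.
  by case: r {J} => /=; case: is_black.
rewrite -/(is_black _) bE; move: J.
by case: r => /=; case: (odd j); case: is_black.
Qed.

(** A strand that separates the black corners turns around the black one, and
stays beside it; a strand that joins them turns around a white corner and
passes to the opposite black one. *)
Lemma black_beside_smooth r c i :
  black_beside (c, smooth r i) =
  black_beside (if joins_black B r c then (c, i + 2) else (c, i)).
Proof.
have two : 2 = 1 + 1 :> 'I_4 by apply/val_inj.
have four : i + 2 = i - 1 - 1.
  by case/or4P: (ord4P i) => /eqP ->; apply/val_inj.
apply/val_inj; rewrite (joins_blackE _ _ i) /smooth /= /black_corner.
case: (joins r i) => /=; rewrite ?(is_blackD1, is_blackB1);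
  have [bi|wi] := boolP (is_black (c, i)) => /=.
- by rewrite four !is_blackB1 bi.
- by rewrite (negPf wi).
- by rewrite bi addrK.
- by rewrite two addrA !is_blackD1 negbK (negPf wi) addrK.
Qed.

Lemma tait_endsE c i :
  tait_ends B c = [set black_beside (c, i); black_beside (c, i + 2)].
Proof.
apply/setP=> R; rewrite !inE; apply/existsP/orP => [[j /eqP Rj]|]; last first.
  case=> /eqP->; rewrite /= /black_corner; case: ifP => _ /=.
  - by exists i. - by exists (i - 1). - by exists (i + 2). - by exists (i + 2 - 1).
have bj : is_black (c, j) by rewrite /is_black -Rj (valP R).
have {Rj}-> : R = black_beside (c, j).
  by apply/val_inj; rewrite /= /black_corner bj.
(* For the separating resolution, smoothing does not change black_beside. *)
pose r := if joins_black B Ares c then Bres else Ares.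
have nr : ~~ joins_black B r c.
  rewrite /r; case: ifP => [|->//].
  by rewrite !(joins_blackE _ _ 0) /=; case: is_black.
have smE j' : black_beside (c, smooth r j') = black_beside (c, j').
  by rewrite black_beside_smooth (negPf nr).
by case: (smooth_cases r i j) => ->; rewrite ?smE eqxx; auto.
Qed.

Lemma mem_state_edges sigma c :
  (c \in state_edges B sigma) = joins_black B (sigma c) c.
Proof. by rewrite !inE; case: (sigma c); rewrite andbF ?orbF andbT. Qed.

(** Gluing and separating smoothings stay beside the same black region; a joining
smoothing moves along an edge of the Tait graph that belongs to the state edges. *)
Lemma connect_black_beside sigma h k :
  connect (state_step sigma) h k ->
  connect (adjacent_in (state_edges B sigma : {set edge (tait_graph B)}))
    (black_beside h) (black_beside k).
Proof.
case/connectP=> p; elim: p h => [|l p IH] h /=; first by move=> _ ->; apply: connect0.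
case/andP=> hl /IH{}IH /IH; apply: connect_trans.
case/orP: hl => /eqP ->; first by rewrite black_beside_glue connect0.
case: h => c i /=; rewrite black_beside_smooth.
case: ifP => [cE|_]; last exact: connect0.
apply/connect1/adjacent_inP; exists c; first by rewrite mem_state_edges.
exact: tait_endsE.
Qed.

(** If every crossing separates the black corners, the state circles are the
boundaries of the black regions: each half-edge is linked to the black corner
beside it, and the black corners are linked in the order of the boundary walk. *)
Lemma card_circles_separated sigma :
  (forall c, ~~ joins_black B (sigma c) c) -> #|classes (state_step sigma)| = #|black B|.
Proof.
move=> sep; rewrite -(card_sig (fun R => R \in black B)).
apply: (card_classes_fun black_beside_surj) => h k.
have smE c i : black_beside (c, smooth (sigma c) i) = black_beside (c, i).
  by rewrite black_beside_smooth (negPf (sep c)).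
have sy := @state_step_sym D sigma.
have cornerP h' : connect (state_step sigma) h' (black_corner h').
  rewrite /black_corner; case: h' => c i; case: ifP => //= wi.
  suff -> : i - 1 = smooth (sigma c) i by apply: state_step_smooth.
  by have := sep c; rewrite (joins_blackE _ _ i) wi /smooth; case: joins.
apply/idP/eqP => [|bb].
  case/connectP=> p; elim: p h => [|l p IH] h /=; first by move=> _ ->.
  case/andP=> hl /IH{}IH /IH <-; case/orP: hl => /eqP ->.
    by rewrite black_beside_glue.
  by case: h => c i; rewrite smE.
have nextP m n : is_black m -> connect (state_step sigma) m (iter n (next_corner D) m).
  move=> bm; elim: n => [|n IH] //=; apply: connect_trans IH _.
  set l := iter n _ m; have bl : is_black l.
    by rewrite /l; elim: (n) => //= n' bn'; rewrite is_black_next.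
  apply: connect_trans (state_step_glue _ _) _.
  suff -> : next_corner D l = black_corner (glue l) by apply: cornerP.
  rewrite /black_corner -[is_black (glue l)]negbK.
  by rewrite [glue l]surjective_pairing -is_blackB1 is_black_next bl.
apply: connect_trans (cornerP h) _; rewrite sy.
apply: connect_trans (cornerP k) _; rewrite sy.
have := congr1 val bb => /eqP /=; rewrite eq_region_at => /iter_findex <-.
exact/nextP/black_corner_black.
Qed.
End Checkerboards.

(** * The circle count and planarity *)

Section Euler.
Local Open Scope ring_scope.
Import GRing.Theory.
Variable D : link_diagram.

Lemma white_regions (B : checkerboard D) : regions D :\: B \subset regions D.
Proof. exact: subsetDl. Qed.

Lemma white_alternate (B : checkerboard D) (c : crossing D) (i : 'I_4) :
  (region_at (c, i + 1) \in regions D :\: B) = (region_at (c, i) \notin regions D :\: B).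
Proof.
have reg h : region_at h \in regions D by apply: imset_f.
by rewrite !inE !reg !andbT black_alternate.
Qed.

(** Exchanging the colors exchanges joining and separating, so that the state
joining all black corners is an instance of card_circles_separated. *)
Definition opposite_coloring (B : checkerboard D) : checkerboard D :=
  Checkerboard (white_regions B) (white_alternate B).

Lemma joins_white (B : checkerboard D) r c :
  joins_black (opposite_coloring B) r c = ~~ joins_black B r c.
Proof.
rewrite !(joins_blackE _ _ _ 0) /is_black /= in_setD.
have -> : region_at (c, 0) \in regions D by apply: imset_f.
by rewrite andbT; case: joins; case: (_ \in _).
Qed.

Variable B : checkerboard D.
Hypothesis D_connected : connected_diagram D.
Hypothesis D_crossing : (0 < #|crossing D|)%N.
Let G := tait_graph B.
Implicit Types E F : {set edge G}.

(** The inverse of state_edges; it lets the induction range over sets of edges. *)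
Definition state_of E : state D :=
  fun c => if (c \in E) == joins_black B Ares c then Ares else Bres.

Lemma joins_black_state_of E c : joins_black B (state_of E c) c = (c \in E).
Proof.
rewrite /state_of; case: eqP => [//|]; rewrite !(joins_blackE _ _ _ 0) /=.
by case: (c \in E); case: is_black.
Qed.

Lemma state_edgesK sigma : state_of (state_edges B sigma) =1 sigma.
Proof.
move=> c; rewrite /state_of mem_state_edges !(joins_blackE _ _ _ 0).
by case: (sigma c); case: is_black.
Qed.

Lemma state_ofK E : state_edges B (state_of E) = E.
Proof. by apply/setP=> c; rewrite mem_state_edges joins_black_state_of. Qed.

Definition circles E : nat := #|classes (state_step (state_of E))|.
Definition comps E : nat := #|components (spanning_subgraph E)|.
Definition black_linked E c : bool :=
  connect (adjacent_in E) (black_beside B (c, 0)) (black_beside B (c, 2)).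

Lemma tait_ends0 c : ends (c : edge G) = [set black_beside B (c, 0); black_beside B (c, 2)].
Proof. by rewrite /= (tait_endsE _ _ 0) add0r. Qed.

Lemma card_regions : #|regions D| = (#|black B| + circles setT)%N.
Proof.
rewrite /circles (card_circles_separated (B := opposite_coloring B)) => [|c].
  by rewrite cardsD (setIidPr (black_regions B)) subnKC ?subset_leq_card ?black_regions.
by rewrite joins_white joins_black_state_of inE.
Qed.

(** Euler's formula, with one component and twice as many edges as crossings. *)
Lemma planar_card : (#|black B| + circles setT = #|crossing D| + 2)%N.
Proof.
have /card_gt0P[c0 _] := D_crossing.
have : (#|crossing D| + (#|black B| + circles setT) =
        #|{: {a | a \in arcs D}}| + 2 * #|components (projection_graph D)|)%N.
  by rewrite -card_regions; apply: pd_planar.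
have -> : #|components (projection_graph D)| = 1%N := card_one_class c0 D_connected.
have -> : #|{: {a | a \in arcs D}}| = #|arcs D| by rewrite card_sig; apply: eq_card.
have : #|[set: half_edge D]| = (#|arcs D| * 2)%N.
  rewrite (card_involution (@glueK D) (@glue_neq D)) //; congr (#|pred_of_set _| * 2)%N.
  by apply/setP=> a; apply/imsetP/imsetP=> -[h _ ->]; exists h.
by rewrite cardsT card_prod card_ord; lia.
Qed.

(** The black regions at one crossing are linked, and an edge of the projection
graph has the same black region beside both of its ends. *)
Lemma tait_connected u v : connect (adjacent_in [set: edge G]) u v.
Proof.
have sy := @adjacent_in_sym G setT.
have [h <-] := black_beside_surj u; have [k <-] := black_beside_surj v.
have local c i j : connect (adjacent_in [set: edge G])
                      (black_beside B (c, i)) (black_beside B (c, j)).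
  have := set21 (black_beside B (c, j)) (black_beside B (c, j + 2)).
  rewrite -tait_endsE (tait_endsE _ _ i) => /set2P[->|->]; first exact: connect0.
  by apply/connect1/adjacent_inP; exists c; rewrite ?inE //= (tait_endsE _ _ i).
have step c c' i j : adjacent (projection_graph D) c c' ->
    connect (adjacent_in [set: edge G]) (black_beside B (c, i)) (black_beside B (c', j)).
  case/existsP=> -[a /= aP] /eqP aE.
  have [l lc lc'] : exists2 l : half_edge D, l.1 = c & (glue l).1 = c'.
    case/imsetP: aP aE => l _ ->; rewrite imsetU1 imset_set1.
    by case/set2_inj=> -[E1 E2]; [exists l | exists (glue l); rewrite ?glueK].
  apply: connect_trans (local _ _ l.2) _; rewrite -lc -surjective_pairing.
  by rewrite -black_beside_glue [glue l]surjective_pairing lc'.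
case: h k => c i [c' j]; have /connectP[p] := D_connected c c'.
elim: p c i => [|c1 p IH] c i /=; first by move=> _ ->; apply: local.
by case/andP=> /(step _ _ i i) cc1 c1p c'E; apply: connect_trans cc1 (IH _ _ c1p c'E).
Qed.

Lemma comps_full : comps setT = 1%N.
Proof.
have /card_gt0P[c0 _] := D_crossing.
exact: (card_one_class (black_beside B (c0, 0)) tait_connected).
Qed.

Lemma circles_empty : circles set0 = #|black B|.
Proof.
by apply: card_circles_separated => c; rewrite joins_black_state_of inE.
Qed.

Lemma circles_add E c : c \notin E ->
  (circles E + ~~ loop_at (state_of (c |: E)) c =
   circles (c |: E) + ~~ loop_at (state_of E) c)%N.
Proof.
move=> cE; apply: card_circles_flip => c' cc'.
by rewrite /state_of !inE (negPf cc').
Qed.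

Lemma loop_at_add E c : c \notin E ->
  ~~ loop_at (state_of E) c -> loop_at (state_of (c |: E)) c.
Proof.
move=> cE; apply: loop_at_flip => [c' cc'|].
  by rewrite /state_of !inE (negPf cc').
apply: contraNneq cE => eqr.
by rewrite -joins_black_state_of eqr joins_black_state_of setU11.
Qed.

Lemma comps_add E c : comps E = (comps (c |: E) + ~~ black_linked E c)%N.
Proof. exact: (card_components_add _ (tait_ends0 c)). Qed.

Lemma loop_linked E c : loop_at (state_of E) c -> black_linked E c.
Proof. by move/(connect_black_beside B); rewrite state_ofK. Qed.

(** Add one edge c.  If its ends are already linked, the components do not change
and at most one circle is gained.  Otherwise one component is lost; the segment of
c then joins two circles (loop_linked), which get merged (loop_at_add), so one
circle is lost. *)
Lemma defect_mono E F : E \subset F ->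
  (circles F + 2 * comps E + #|E| <= circles E + 2 * comps F + #|F|)%N.
Proof.
move: {2}#|F :\: E| (erefl #|F :\: E|) => n; elim: n E => [|n IH] E FE sEF.
  suff -> : E = F by [].
  by apply/eqP; rewrite eqEsubset sEF -setD_eq0 -cards_eq0 FE.
have /card_gt0P[c /setDP[cF cE]] : (0 < #|F :\: E|)%N by rewrite FE.
have scEF : c |: E \subset F by rewrite subUset sub1set cF.
have cFE : #|F :\: (c |: E)| = n.
  have := cardsD1 c (F :\: E); rewrite FE !inE cF cE add1n => -[->].
  by rewrite setDDl setUC.
have := IH _ cFE scEF; have := circles_add cE; have := comps_add E c.
have := @loop_linked E c; have := loop_at_add cE; rewrite cardsU1 cE.
case: (loop_at _ c); case: (loop_at _ c); case: (black_linked _ _) => //=; lia.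
Qed.

(** The defect of defect_mono takes the same value on the empty and on the full set
of edges, hence on all sets between them. *)
Lemma circles_comps E : (circles E + #|black B| = 2 * comps E + #|E|)%N.
Proof.
have := defect_mono (sub0set E); have := defect_mono (subsetT E).
have := planar_card; rewrite comps_full circles_empty cards0 cardsT.
have -> : comps set0 = #|black B|.
  by rewrite /comps card_components_set0 card_sig; apply: eq_card.
rewrite /=; lia.
Qed.

(** Compare the count for E and for c |: E: the number of circles goes up by one
if the ends of c are linked and down by one otherwise, and by card_circles_flip
either change determines both loops. *)
Lemma loop_at_linked E c : c \notin E ->
  loop_at (state_of E) c = black_linked E c /\
  loop_at (state_of (c |: E)) c = ~~ black_linked E c.
Proof.
move=> cE; have := circles_comps E; have := circles_comps (c |: E).
have := circles_add cE; have := comps_add E c; rewrite cardsU1 cE.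
by case: (loop_at _ c); case: (loop_at _ c); case: (black_linked _ _) => /=; lia.
Qed.

End Euler.

Theorem theorem1p1 (D : link_diagram) (B : checkerboard D) (sigma : state D) :
  connected_diagram D -> reduced D -> 0 < #|crossing D| ->
  let G := tait_graph B in
  let E : {set edge G} := state_edges B sigma in
  let GE := spanning_subgraph E in
  adequate sigma <->
  (forall e : edge GE,
     exists s : seq (vertex GE * edge GE), is_cycle s /\ e \in unzip2 s) /\
  (forall e : edge G, e \in ~: E ->
     ~ exists K : {set vertex GE}, K \in components GE /\ ends e \subset K).
Proof.
move=> Dconn _ Dcross G E GE.
have loopE c : loop_at (state_of E) c = loop_at sigma c.
  by apply: eq_connect; apply: eq_state_step; apply: state_edgesK.
have cycleP (e : edge GE) :
    (exists s : seq (vertex GE * edge GE), is_cycle s /\ e \in unzip2 s) <->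
    ~~ loop_at sigma (val e).
  (* An edge of E lies on a cycle iff its ends are linked without it. *)
  rewrite (in_cycleP (e := e) (tait_ends0 (val e))) -loopE.
  have eE' : val e \notin E :\ val e by rewrite !inE eqxx.
  have [_] := loop_at_linked Dconn Dcross eE'; rewrite setD1K ?(valP e) // => ->.
  rewrite negbK /black_linked; set u := black_beside _ _; set v := black_beside _ _.
  suff -> : connect (adjacent_in [set~ e]) u v = connect (adjacent_in (E :\ val e)) u v by [].
  apply: eq_connect => a b; apply/adjacent_inP/adjacent_inP.
    case=> -[f fE]; rewrite !inE -(inj_eq val_inj) => fe fab.
    by exists f; rewrite // in_setD1 fe.
  case=> f /setD1P[fe fE] fab; exists (Sub f fE) => //.
  by rewrite !inE.
have apartP (e : edge G) : e \in ~: E ->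
    (~ exists K : {set vertex GE}, K \in components GE /\ ends e \subset K) <->
    ~~ loop_at sigma e.
  rewrite inE => eE; rewrite -(in_one_componentP E (tait_ends0 e)) -loopE.
  by have [-> _] := loop_at_linked Dconn Dcross eE; split=> /negP.
rewrite adequateP; split=> [nl | [cyc apart] c].
  by split=> [e | e eE]; [apply/cycleP | apply/apartP].
have [cE | cE] := boolP (c \in E); first by apply/(cycleP (Sub c cE)).
have {}cE : c \in ~: E by rewrite inE.
exact/(apartP _ cE)/(apart _ cE).
Qed.
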